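(* For every integer $k\ge 4$ we have $RR^{*}(C_2,A_k)\ge k+2$. In particular, $RR^*(C_2,A_k)$ is larger than both $e^*(C_2)(|A_k|-1)+f(A_k)=k+1$ and $R^{*}_{k-1}(C_2)=k-1$.
   Context: $B_n$ is the Boolean lattice of all subsets of $[n]=\{1,\dots,n\}$ ordered by inclusion; a level of $B_n$ is the collection of all sets of a given size. $C_2$ is the two-element chain and $A_k$ is the antichain on $k$ elements. A subset $X$ of a poset $R$ is a strong (induced) copy of a poset $P$ if there is a bijection $\alpha:P\to X$ such that $p\le_P p'$ if and only if $\alpha(p)\le_R\alpha(p')$. A copy is monochromatic with respect to a coloring if all its elements have the same color, and rainbow if its elements have pairwise distinct colors. $RR^*(P,Q)$ is the minimum $n$ such that any coloring of $B_n$ (with colors from $\mathbb{N}$, any number of colors) admits either a monochromatic strong copy of $P$ or a rainbow strong copy of $Q$. $R^*_k(P)$ is the smallest $n$ such that any coloring of $B_n$ with $k$ colors admits a monochromatic strong copy of $P$. $e^*(P)$ is the maximum number $m$ such that for every $n$ the union of any $m$ consecutive levels of $B_n$ contains no strong copy of $P$. For a poset $Q$, $f(Q)=0$ if $Q$ has both a unique largest and a unique smallest element, $f(Q)=2$ if $Q$ has neither a largest nor a smallest element, and $f(Q)=1$ otherwise. *)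

(* Defs.v *)
(* MathComp; the extremal numbers use classical choice. *)
From HB Require Import structures.
From mathcomp Require Import all_boot all_order.
From mathcomp Require classical_sets.

Set Implicit Arguments.
Unset Strict Implicit.
Unset Printing Implicit Defensive.

Definition boolean_lattice (n : nat) : Type := {set 'I_n}.
HB.instance Definition _ n := Finite.copy (boolean_lattice n) {set 'I_n}.
Fact inclusion_display : Order.disp_t. Proof. exact: Order.Disp tt tt. Qed.
HB.instance Definition _ n := Order.Le_isPOrder.Build
  inclusion_display (boolean_lattice n)
  (fun A => subxx (A : {set 'I_n}))
  (@Order.SetSubsetOrder.le_anti inclusion_display 'I_n)
  (fun B A C : {set 'I_n} => @subset_trans _ A B C).

Lemma le_boolean_lattice n (A B : boolean_lattice n) :
  (A <= B)%O = ((A : {set 'I_n}) \subset (B : {set 'I_n})).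
Proof. by []. Qed.

Definition chain (k : nat) : Type := 'I_k.
HB.instance Definition _ k := Order.FinPOrder.copy (chain k) 'I_k.

Lemma le_chain k (i j : chain k) :
  (i <= j)%O = ((i : 'I_k) <= (j : 'I_k))%N.
Proof. by []. Qed.

Definition antichain (k : nat) : Type := 'I_k.
HB.instance Definition _ k := Finite.copy (antichain k) 'I_k.

Section AntichainOrder.
Variable k : nat.
Let eq_le : rel (antichain k) := fun x y => x == y.
Fact antichain_refl : reflexive eq_le.
Proof. exact: eqxx. Qed.
Fact antichain_anti : antisymmetric eq_le.
Proof. by move=> x y /andP[/eqP]. Qed.
Fact antichain_trans : transitive eq_le.
Proof. by move=> y x z /eqP-> /eqP->; apply: eqxx. Qed.
End AntichainOrder.
Fact antichain_display : Order.disp_t. Proof. exact: Order.Disp tt tt. Qed.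
HB.instance Definition _ k := Order.Le_isPOrder.Build
  antichain_display (antichain k)
  (@antichain_refl k) (@antichain_anti k) (@antichain_trans k).

Lemma le_antichain k (x y : antichain k) : (x <= y)%O = (x == y).
Proof. by []. Qed.

Definition strong_copy d (P : finPOrderType d) d' (R : finPOrderType d')
    (X : {set R}) : Prop :=
  exists alpha : P -> R,
    [/\ injective alpha, alpha @: [set: P] = X &
        forall p p' : P, (p <= p')%O <-> (alpha p <= alpha p')%O].

Definition monochromatic (T : finType) (color : Type) (c : T -> color)
    (X : {set T}) : Prop :=
  {in X &, forall x y, c x = c y}.

Definition rainbow (T : finType) (color : Type) (c : T -> color)
    (X : {set T}) : Prop :=
  {in X &, injective c}.

Definition is_least (S : nat -> Prop) (m : nat) : Prop :=
  S m /\ forall n, S n -> m <= n.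

Definition is_greatest (S : nat -> Prop) (m : nat) : Prop :=
  S m /\ forall n, S n -> n <= m.

(* Both extrema are 0 when they do not exist, so a positive lower bound on one
   of them entails its existence. *)
Definition least (S : nat -> Prop) : nat := classical_sets.xget 0 (is_least S).
Definition greatest (S : nat -> Prop) : nat := classical_sets.xget 0 (is_greatest S).

Definition RRstar d (P : finPOrderType d) d' (Q : finPOrderType d') : nat :=
  least (fun n => forall c : boolean_lattice n -> nat,
    (exists X, strong_copy P X /\ monochromatic c X) \/
    (exists X, strong_copy Q X /\ rainbow c X)).

Definition Rstar (k : nat) d (P : finPOrderType d) : nat :=
  least (fun n => forall c : boolean_lattice n -> 'I_k,
    exists X, strong_copy P X /\ monochromatic c X).

(* The union of the m consecutive levels a, ..., a + m - 1 of B_n. *)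
Definition levels (n a m : nat) : {set boolean_lattice n} :=
  [set x : boolean_lattice n | a <= #|(x : {set 'I_n})| < a + m].

Definition estar d (P : finPOrderType d) : nat :=
  greatest (fun m => forall n a, a + m <= n.+1 ->
    ~ exists2 X, strong_copy P X & X \subset levels n a m).

Definition has_largest d (Q : finPOrderType d) : bool :=
  [exists x : Q, [forall y : Q, (y <= x)%O]].

Definition has_smallest d (Q : finPOrderType d) : bool :=
  [exists x : Q, [forall y : Q, (x <= y)%O]].

Definition fext d (Q : finPOrderType d) : nat :=
  if has_largest Q && has_smallest Q then 0
  else if ~~ has_largest Q && ~~ has_smallest Q then 2
  else 1.

(* Main.v *)
(** A level of [B_n] contains no [C_2], so colouring by cardinality never yields
    a monochromatic [C_2].  In [B_(k+1)] a rainbow [A_k] for this colouring would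
    meet every level from 1 to [k]: its singleton [{x}] is incomparable only to
    the co-singleton [~{x}], while its 2-set is incomparable to [{x}] only if it
    avoids [x], that is, only if it lies below [~{x}].

    A positive lower bound on [RRstar] also needs its existence.  In a colouring
    without monochromatic [C_2] chains are rainbow, so from [k] mutually
    incomparable chains with [k] elements each (they exist in [B_(2k)]) one
    greedily picks elements of distinct colours. *)
Require Import Defs.
From mathcomp Require Import all_boot all_order.
From mathcomp Require boolp classical_sets.

Set Implicit Arguments.
Unset Strict Implicit.
Unset Printing Implicit Defensive.

(** * Least and greatest elements of sets of naturals *)

Lemma least_spec (S : nat -> Prop) n : S n -> is_least S (least S).
Proof.
move=> Sn; apply: (@classical_sets.xgetPex _ 0 (is_least S)).
suff [m mP] : exists m, is_least S m by exists m.
(* [S] need not be decidable, so the descent to a minimal member uses excluded middle to tell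
   whether a smaller member exists. *)
have [m [Sm mmin]] : exists m, S m /\ forall j, j < m -> ~ S j.
  elim/ltn_ind: n Sn => n IH Sn.
  have [[j jn Sj]|noj] := boolp.pselect (exists2 j, j < n & S j).
    exact: IH Sj.
  by exists n; split=> // j jn Sj; apply: noj; exists j.
exists m; split=> // j Sj; rewrite leqNgt; apply/negP => jm.
exact: mmin Sj.
Qed.

Lemma least_eq (S : nat -> Prop) m : is_least S m -> least S = m.
Proof.
move=> [Sm mmin]; have [Sl lmin] := least_spec Sm.
by apply/eqP; rewrite eqn_leq lmin //= mmin.
Qed.

(** The member [n] keeps [least S] from being the default 0. *)
Lemma least_geq (S : nat -> Prop) n m :
  S n -> (forall j, S j -> m <= j) -> m <= least S.
Proof. by move=> /least_spec[Sl _]; apply. Qed.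

Lemma greatest_eq (S : nat -> Prop) m : is_greatest S m -> greatest S = m.
Proof.
move=> gm; have [Sg gmax] : is_greatest S (greatest S).
  exact: (classical_sets.xgetI 0 gm).
by case: gm => Sm mmax; apply/eqP; rewrite eqn_leq mmax //= gmax.
Qed.

(** * Copies of $C_2$ as comparable pairs *)

Section Chain2.
Variables (d : Order.disp_t) (R : finPOrderType d).

Lemma strong_copy_chain2 (X : {set R}) : strong_copy (chain 2) X ->
  exists x y, [/\ x \in X, y \in X & (x < y)%O].
Proof.
move=> [alpha [inj_alpha <- le_alpha]].
exists (alpha (ord0 : 'I_2)), (alpha (ord_max : 'I_2)).
rewrite !imset_f ?inE // Order.POrderTheory.lt_neqAle; split=> //.
rewrite (inj_eq inj_alpha); apply/andP; split=> //.
exact/le_alpha.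
Qed.

Lemma strong_copy_pair (x y : R) :
  (x < y)%O -> strong_copy (chain 2) [set x; y].
Proof.
move=> xy; pose alpha (i : chain 2) := if (i : 'I_2) == ord0 then x else y.
have xNy : (x == y) = false by apply/negbTE; rewrite Order.POrderTheory.lt_eqF.
have yNx : (y <= x)%O = false.
  by apply/negbTE; rewrite Order.POrderTheory.lt_geF.
exists alpha; split.
- move=> [[|[|//]] ?] [[|[|//]] ?]; rewrite /alpha /= => /eqP;
    rewrite ?xNy ?[y == x]eq_sym ?xNy // => _; exact: val_inj.
- apply/setP=> z; rewrite !inE; apply/imsetP/orP.
    by move=> [i _ ->]; rewrite /alpha; case: ifP; [left|right].
  case=> /eqP->; first by exists (ord0 : 'I_2).
  by exists (ord_max : 'I_2).
- by move=> [[|[|//]] ?] [[|[|//]] ?]; rewrite le_chain /alpha /=;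
    rewrite ?yNx ?Order.POrderTheory.lexx // Order.POrderTheory.ltW.
Qed.

Lemma chain2_free_lt_color (color : Type) (c : R -> color) :
  ~ (exists X, strong_copy (chain 2) X /\ monochromatic c X) ->
  forall x y, (x < y)%O -> c x <> c y.
Proof.
move=> noX x y xy cxy; apply: noX; exists [set x; y].
split; first exact: strong_copy_pair.
by move=> u v; rewrite !inE => /orP[]/eqP-> /orP[]/eqP->.
Qed.

End Chain2.

(** * Levels and initial segments of $B_n$ *)

Definition rank n (A : boolean_lattice n) : nat := #|(A : {set 'I_n})|.

Lemma rank_lt n (A B : boolean_lattice n) : (A < B)%O -> rank A < rank B.
Proof.
rewrite Order.POrderTheory.lt_neqAle le_boolean_lattice => /andP[AB sAB].
by apply: proper_card; rewrite properEneq AB sAB.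
Qed.

(** Stated for every colouring that determines the rank, so that it serves both for [rank] itself
    and for [rank] with values in ['I_k]. *)
Lemma rank_no_mono_chain2 n (color : Type) (c : boolean_lattice n -> color) :
  (forall A B, c A = c B -> rank A = rank B) ->
  ~ exists X, strong_copy (chain 2) X /\ monochromatic c X.
Proof.
move=> c_rank [X [/strong_copy_chain2[A [B [AX BX /rank_lt AB]]] monoX]].
by rewrite (c_rank _ _ (monoX _ _ AX BX)) ltnn in AB.
Qed.

Lemma initial_segment_lt n i j : i < j -> j <= n ->
  (([set x : 'I_n | (x < i)%N] : boolean_lattice n) <
   ([set x : 'I_n | (x < j)%N] : boolean_lattice n))%O.
Proof.
move=> ij jn; rewrite Order.POrderTheory.lt_neqAle le_boolean_lattice.
apply/andP; split.
  apply/eqP => /setP /(_ (Ordinal (leq_trans ij jn))).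
  by rewrite !inE /= ltnn ij.
by apply/subsetP => x; rewrite !inE => /ltn_trans; apply.
Qed.

(** * The values of $R^*_k(C_2)$, $e^*(C_2)$ and $f(A_k)$ *)

(** The $k+1$ initial segments of $[k]$ form a chain, so two of them share a colour; for $n < k$
    there are at most $k$ levels, and each can have its own colour. *)
Lemma Rstar_chain2 k : 0 < k -> Rstar k (chain 2) = k.
Proof.
move=> k_gt0; apply: least_eq; split=> [c|n Sn].
  have [//|noX] := boolp.pselect (exists X, strong_copy (chain 2) X /\
    monochromatic c X).
  have lt_c := chain2_free_lt_color noX.
  pose f (i : 'I_k.+1) : 'I_k := c [set x : 'I_k | x < i].
  suff /leq_card : injective f by rewrite !card_ord ltnn.
  move=> i j fij; apply/val_inj; case: (ltngtP i j) => // ltij.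
    by case: (lt_c _ _ (initial_segment_lt ltij (ltn_ord j))).
  by case: (lt_c _ _ (initial_segment_lt ltij (ltn_ord i))).
rewrite leqNgt; apply/negP => nk.
have rk (A : boolean_lattice n) : rank A < k.
  by apply: leq_ltn_trans nk; rewrite -[n in _ <= n]card_ord max_card.
by case: (@rank_no_mono_chain2 n _ (fun A => Ordinal (rk A))) => [A B [//]|].
Qed.

Lemma estar_chain2 : estar (chain 2) = 1.
Proof.
apply: greatest_eq; split=> [n a _ [X copyX /subsetP sX]|m Sm].
  have [A [B [/sX + /sX + /rank_lt]]] := strong_copy_chain2 copyX.
  rewrite /rank !inE addn1 !ltnS -!eqn_leq => /eqP<- /eqP<-.
  by rewrite ltnn.
rewrite leqNgt; apply/negP => m_gt1.
(* In $B_m$ with $m > 1$, the levels $0, \dots, m-1$ already contain the empty set and the first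
   singleton. *)
apply: (Sm m 0) => //; eexists.
  exact: strong_copy_pair (initial_segment_lt (ltn0Sn 0) (ltnW m_gt1)).
apply/subsetP => A; rewrite !inE add0n /= => /orP[]/eqP->.
  by rewrite (_ : finset _ = set0) ?cards0 ?(ltnW m_gt1) //;
    apply/setP => x; rewrite !inE.
rewrite (_ : finset _ = [set Ordinal (ltnW m_gt1)]) ?cards1 //.
by apply/setP => x; rewrite !inE ltnS leqn0.
Qed.

Lemma fext_antichain k : 1 < k -> fext (antichain k) = 2.
Proof.
move=> k_gt1.
have other (x : antichain k) : exists y : antichain k, y != x.
  have : 0 < #|[set~ x]| by rewrite cardsC1 card_ord -ltnS prednK // ltnW.
  by case/card_gt0P => y; rewrite !inE; exists y.
rewrite /fext ifF ?ifT //.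
  apply/andP; split; apply/existsP => -[x /forallP].
    by have [y /negbTE yx] := other x => /(_ y); rewrite le_antichain yx.
  have [y /negbTE yx] := other x => /(_ y).
  by rewrite le_antichain eq_sym yx.
apply/negP => /andP[/existsP[x /forallP] + _].
by have [y /negbTE yx] := other x => /(_ y); rewrite le_antichain yx.
Qed.

(** * Existence of $RR^*(C_2, A_k)$ *)

(* Read with c i j the colour of the j-th element of the i-th chain. *)
Lemma greedy_distinct (color : eqType) k (c : nat -> nat -> color) :
  (forall i, i < k -> {in [pred j | j < k] &, injective (c i)}) ->
  exists2 g : nat -> nat, (forall i, g i <= k) &
    {in [pred i | i < k] &, injective (fun i => c i (g i))}.
Proof.
move=> inj_c.
suff H m : m <= k -> exists2 g : nat -> nat, (forall i, g i <= k) &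
    {in [pred i | i < m] &, injective (fun i => c i (g i))} by exact: H.
elim: m => [_|m IH mk]; first by exists (fun=> 0) => // i j; rewrite inE.
have [g g_le g_inj] := IH (ltnW mk).
pose used := [seq c i (g i) | i <- iota 0 m].
(* Pigeonhole: the chain numbered [m] shows [k] distinct colours, while at most [m < k] colours have
   been used. *)
have [j jk jNused] : exists2 j, j < k & c m j \notin used.
  have [/hasP[j]|/hasPn no] :=
      boolP (has (fun j => c m j \notin used) (iota 0 k)).
    by rewrite mem_iota; exists j.
  have uniq_m : uniq [seq c m j | j <- iota 0 k].
    rewrite map_inj_in_uniq ?iota_uniq // => i j.
    by rewrite !mem_iota !add0n => *; apply: (inj_c _ mk).
  have /(uniq_leq_size uniq_m) : {subset [seq c m j | j <- iota 0 k] <= used}.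
    by move=> _ /mapP[j /no/negPn + ->].
  by rewrite !size_map !size_iota leqNgt mk.
have new i : i < m -> c i (g i) <> c m j.
  move=> im E; case/negP: jNused; rewrite -E.
  by apply: (map_f (fun i => c i (g i))); rewrite mem_iota.
exists (fun i => if i == m then j else g i) => [i|i i'].
  by case: ifP => // _; apply: ltnW.
rewrite !inE !ltnS (leq_eqVlt i) (leq_eqVlt i').
case: eqVneq => [->|_] /= im; case: eqVneq => [->|_] //= i'm.
- by move=> E; case: (new _ i'm).
- by move=> E; case: (new _ im).
- exact: g_inj.
Qed.

Lemma rainbow_antichain_exists k (c : boolean_lattice (k + k) -> nat) :
  (exists X, strong_copy (chain 2) X /\ monochromatic c X) \/
  (exists X, strong_copy (antichain k) X /\ rainbow c X).
Proof.
have [|noX] := boolp.pselect (exists X, strong_copy (chain 2) X /\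
    monochromatic c X); [by left | right].
have lt_c := chain2_free_lt_color noX.
(* The first half of the ground set labels the chain and the second half gives it length: [s i j]
   consists of [i] and the first [j] elements of the second half. Any [s i' j'] above it contains
   the label [i], which forces [i' = i]. *)
pose s i j : boolean_lattice (k + k) :=
  [set x : 'I_(k + k) | (x == i :> nat) || (k <= x < k + j)].
have s_lt i j j' : i < k -> j < j' -> j' <= k -> (s i j < s i j')%O.
  move=> ik jj' j'k.
  rewrite Order.POrderTheory.lt_neqAle le_boolean_lattice; apply/andP; split.
    have kj : k + j < k + k by rewrite ltn_add2l (leq_trans jj').
    apply/eqP => /setP /(_ (Ordinal kj)); rewrite !inE /=.
    by rewrite leq_addr !ltn_add2l ltnn jj' gtn_eqF // ltn_addr.
  apply/subsetP => x; rewrite !inE => /orP[->//|/andP[-> xj]].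
  by rewrite (leq_trans xj) ?orbT // leq_add2l ltnW.
have s_le i i' j j' : i < k -> i' < k -> (s i j <= s i' j')%O -> i = i'.
  move=> ik i'k; rewrite le_boolean_lattice => /subsetP.
  move/(_ (Ordinal (ltn_addr k ik))); rewrite !inE /= eqxx => /(_ isT).
  by rewrite leqNgt ik orbF => /eqP.
have [|g g_le g_inj] := @greedy_distinct nat k (fun i j => c (s i j)).
  move=> i ik j j'; rewrite !inE => jk j'k E.
  case: (ltngtP j j') => // ltjj'.
    by case: (lt_c _ _ (s_lt _ _ _ ik ltjj' (ltnW j'k))).
  by case: (lt_c _ _ (s_lt _ _ _ ik ltjj' (ltnW jk))).
pose alpha (i : antichain k) := s (i : 'I_k) (g (i : 'I_k)).
exists (alpha @: [set: antichain k]); split.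
  exists alpha; split=> // [i i' E|i i'].
    have : (alpha i <= alpha i')%O by rewrite E Order.POrderTheory.lexx.
    by move=> /(s_le _ _ _ _ (ltn_ord i) (ltn_ord i')) ?; apply/val_inj.
  rewrite le_antichain; split=> [/eqP->|]; first exact: Order.POrderTheory.lexx.
  by move=> /(s_le _ _ _ _ (ltn_ord i) (ltn_ord i')) E; apply/eqP/val_inj.
move=> _ _ /imsetP[i _ ->] /imsetP[i' _ ->] E.
by congr alpha; apply/val_inj/g_inj; rewrite ?inE ?ltn_ord.
Qed.

(** * The lower bound on $RR^*(C_2, A_k)$ *)

(** With an inequality on [n], one statement excludes every dimension below $k+2$. *)
Lemma no_rank_rainbow_antichain n k (X : {set boolean_lattice n}) :
  2 < k -> n <= k.+1 -> strong_copy (antichain k) X -> ~ rainbow (@rank n) X.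
Proof.
move=> k_gt2 n_le [alpha [inj_alpha <- le_alpha]] rainX.
have sub_alpha i j : (alpha i : {set 'I_n}) \subset alpha j -> i = j.
  by move=> /le_alpha; rewrite le_antichain => /eqP.
have inj_rank : injective (fun i => rank (alpha i)).
  by move=> i j /rainX E; apply: inj_alpha; apply: E; apply: imset_f.
have other (i : antichain k) : exists j : antichain k, j <> i.
  have : 0 < #|[set~ i]| by rewrite cardsC1 card_ord; case: (k) k_gt2 => [|[]].
  by case/card_gt0P => j; rewrite !inE => /eqP; exists j.
(* The empty and the full set are comparable to everything, so they cannot belong to an antichain
   with another member. *)
have rank_gt0 i : 0 < rank (alpha i).
  rewrite card_gt0; apply/eqP => E; have [j ji] := other i.
  by apply/ji/esym/sub_alpha; rewrite E sub0set.
have rank_lt_n i : rank (alpha i) < n.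
  rewrite -[n in _ < n]card_ord -cardsT; apply: proper_card.
  rewrite properE subsetT; apply/negP => E; have [j ji] := other i.
  by apply/ji/sub_alpha; apply: subset_trans E; apply: subsetT.
have rank_le i : (rank (alpha i)).-1 < k.
  by rewrite prednK // -ltnS (leq_trans (rank_lt_n i)).
(* Ranks lowered by one give an injective self-map of a [k]-element set; it is onto, so every rank
   from 1 to [k] occurs. *)
pose r (i : antichain k) : antichain k := (Ordinal (rank_le i) : 'I_k).
have inj_r : injective r.
  move=> i j [E]; apply: inj_rank.
  by rewrite -[rank (alpha i)]prednK // E prednK.
have [s _ rs] := injF_bij inj_r.
have rankP m : m < k -> exists i, rank (alpha i) = m.+1.
  move=> mk; exists (s (Ordinal mk : 'I_k)).
  by have [E] := rs (Ordinal mk : 'I_k); rewrite -[RHS](congr1 succn E) prednK.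
have [i1 r1] := rankP 0 (ltn_trans (isT : 0 < 2) k_gt2).
have [i2 r2] := rankP 1 (ltn_trans (isT : 1 < 2) k_gt2).
have [ik rk] : exists i, rank (alpha i) = k.
  by have [|i] := rankP k.-1; rewrite prednK ?(ltn_trans _ k_gt2) //; exists i.
have /eqP/cards1P[x Ex] := r1.
(* A member of rank [k] that is not the full set forces [n > k], and its complement is then a
   singleton. *)
have nE : n = k.+1.
  by apply/eqP; rewrite eqn_leq n_le -rk rank_lt_n.
have /eqP/cards1P[y Ey] : #|~: (alpha ik : {set 'I_n})| = 1.
  apply/eqP; rewrite -(eqn_add2l #|(alpha ik : {set 'I_n})|) cardsC card_ord.
  by rewrite -[#|_|]/(rank _) rk nE addn1.
have yx : y = x.
  apply/eqP; apply: contraT => yx.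
  have /sub_alpha E : (alpha i1 : {set 'I_n}) \subset alpha ik.
    by rewrite Ex sub1set -[_ \in _]negbK -in_setC Ey inE eq_sym.
  by move: r1; rewrite E rk => k1; rewrite k1 in k_gt2.
have xN2 : x \notin (alpha i2 : {set 'I_n}).
  apply/negP => x2; have /sub_alpha E : (alpha i1 : {set 'I_n}) \subset alpha i2.
    by rewrite Ex sub1set.
  by move: r1; rewrite E r2.
have /sub_alpha E : (alpha i2 : {set 'I_n}) \subset alpha ik.
  by rewrite -[alpha ik : {set _}]setCK Ey yx subsetC sub1set in_setC.
by move: r2; rewrite E rk => k2; rewrite k2 ltnn in k_gt2.
Qed.

Lemma RRstar_chain2_antichain_ge k :
  2 < k -> k + 2 <= RRstar (chain 2) (antichain k).
Proof.
move=> k_gt2; apply: least_geq (@rainbow_antichain_exists k) _ => n Sn.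
rewrite leqNgt addn2 ltnS; apply/negP => n_le.
have [|[X [copyX]]] := Sn (@rank n); first exact: rank_no_mono_chain2.
exact: no_rank_rainbow_antichain copyX.
Qed.

Theorem mainTheorem5 (k : nat) (hk : 4 <= k) :
  [/\ k + 2 <= RRstar (chain 2) (antichain k),
      estar (chain 2) * (#|{: antichain k}| - 1) + fext (antichain k) = k + 1,
      estar (chain 2) * (#|{: antichain k}| - 1) + fext (antichain k)
        < RRstar (chain 2) (antichain k),
      Rstar (k - 1) (chain 2) = k - 1 &
      Rstar (k - 1) (chain 2) < RRstar (chain 2) (antichain k)].
Proof.
have RRge : k + 2 <= RRstar (chain 2) (antichain k).
  by apply: RRstar_chain2_antichain_ge; apply: ltnW.
have k_gt1 : 1 < k by apply: leq_trans hk.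
have formula :
    estar (chain 2) * (#|{: antichain k}| - 1) + fext (antichain k) = k + 1.
  rewrite estar_chain2 fext_antichain // card_ord mul1n.
  by rewrite -(addn1 1) addnA subnK // ltnW.
have RE : Rstar (k - 1) (chain 2) = k - 1 by rewrite Rstar_chain2 // subn_gt0.
split=> //.
  by rewrite formula -addnS.
rewrite RE; apply: leq_trans RRge.
by rewrite addn2 ltnS (leq_trans (leq_subr _ _)).
Qed.
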